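(* Let $\beta\in(0,2)$. The operator $-(-\Delta)^{\frac{\beta}{2}}$, the negative of the fractional power of order $\frac{\beta}{2}$ of the (negative) discrete Laplacian on $\mathbb{Z}$, fails to satisfy $CD(0,d)$ for all finite $d>0$.
   Context: The discrete Laplacian on $\mathbb{Z}$ is $\Delta u(x)=u(x+1)-2u(x)+u(x-1)$. Its fractional powers are defined by the semigroup method: $-(-\Delta)^{\frac{\beta}{2}}u(x)=\frac{1}{\Gamma(-\frac{\beta}{2})}\int_0^\infty\big(u-e^{t\Delta}u\big)(x)\frac{dt}{t^{1+\frac{\beta}{2}}}$, where here $\Gamma$ is the Gamma function. It is known that this operator is of the form $\mathcal{L}u(x)=\sum_{j\in\mathbb{Z}}k_\beta(j)\big(u(x+j)-u(x)\big)$ with the kernel $k_\beta(0)=0$ and $$k_\beta(j)=\frac{4^{\frac{\beta}{2}}\,\Gamma\left(\frac{1+\beta}{2}\right)\Gamma\left(|j|-\frac{\beta}{2}\right)}{\sqrt{\pi}\,\left|\Gamma\left(-\frac{\beta}{2}\right)\right|\Gamma\left(|j|+1+\frac{\beta}{2}\right)},\quad j\in\mathbb{Z}\setminus\{0\},$$ and that there are constants $0<c(\beta)\le C(\beta)$ with $c(\beta)|j|^{-1-\beta}\le k_\beta(j)\le C(\beta)|j|^{-1-\beta}$ for all $j\in\mathbb{Z}\setminus\{0\}$; the operator is understood in this form for all functions $u$ admissible below. For a nonnegative, summable, symmetric, nontrivial kernel $k$ on $\mathbb{Z}$ with $k(0)=0$ and associated operator $\mathcal{L}u(x)=\sum_{j\in\mathbb{Z}}k(j)\big(u(x+j)-u(x)\big)$,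 one sets $\Gamma_2(u)(x)=\frac14\sum_{j,l\in\mathbb{Z}}k(j)k(l)\big(u(x+j+l)-u(x+j)-u(x+l)+u(x)\big)^2\in[0,\infty]$. A function $u:\mathbb{Z}\to\mathbb{R}$ is admissible for $CD(0,d)$ at $x\in\mathbb{Z}$ if $\sum_{j\in\mathbb{Z}}k(j)|u(x+j)|<\infty$. For $d\in(0,\infty)$, $\mathcal{L}$ satisfies $CD(0,d)$ if $\Gamma_2(u)(x)\ge\frac1d\big(\mathcal{L}u(x)\big)^2$ for every $x\in\mathbb{Z}$ and every $u$ admissible at $x$; it fails to satisfy $CD(0,d)$ if this does not hold. *)

(* Defs.v *)
From HB Require Import structures.
From mathcomp Require Import all_boot all_order all_algebra.
From mathcomp Require Import all_classical all_reals all_analysis.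

Set Implicit Arguments.
Unset Strict Implicit.
Unset Printing Implicit Defensive.

Import Order.TTheory GRing.Theory Num.Theory.
Import numFieldNormedType.Exports.

Local Open Scope classical_set_scope.
Local Open Scope ring_scope.

Definition euler_integral {R : realType} (x : R) : R :=
  \int[@lebesgue_measure R]_(t in `]0, +oo[) (t `^ (x - 1) * expR (- t)).

(* Euler's integral for x > 0, continued to x <= 0 by
   Gamma x = Gamma (x + n) / (x (x + 1) ... (x + n - 1)), where n is the least
   natural number such that 0 < x + n.  At the poles 0, -1, -2, ... the
   product vanishes and the value is the junk value 0. *)
Definition Gamma {R : realType} (x : R) : R :=
  let n := if 0 < x then 0%N else (Num.truncn (- x)).+1 in
  euler_integral (x + n%:R) / \prod_(i < n) (x + i%:R).

(* The sum of an absolutely summable family; \esum is only meaningful for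
   nonnegative families, hence the two parts. *)
Definition zsum {R : realType} (f : int -> R) : R :=
  fine (\esum_(j in [set: int]) ((EFin \o f)^\+)%E j) -
  fine (\esum_(j in [set: int]) ((EFin \o f)^\-)%E j).

Definition nonlocal_op {R : realType} (k : int -> R) (u : int -> R) (x : int)
    : R :=
  zsum (fun j => k j * (u (x + j) - u x)).

Definition Gamma2 {R : realType} (k : int -> R) (u : int -> R) (x : int)
    : \bar R :=
  ((4^-1)%:E * \esum_(p in [set: int * int])
     (k p.1 * k p.2 *
      (u (x + p.1 + p.2) - u (x + p.1) - u (x + p.2) + u x) ^+ 2)%:E)%E.

Definition admissible {R : realType} (k : int -> R) (u : int -> R) (x : int)
    : Prop :=
  (\esum_(j in [set: int]) (k j * `|u (x + j)|)%:E < +oo)%E.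

(* CD(0,d) for the operator [nonlocal_op k]. *)
Definition CD0 {R : realType} (k : int -> R) (d : R) : Prop :=
  forall (x : int) (u : int -> R), admissible k u x ->
    ((d^-1 * nonlocal_op k u x ^+ 2)%:E <= Gamma2 k u x)%E.

(* [nonlocal_op (frac_kernel beta)] is - (- Delta)^(beta / 2), Delta being the
   discrete Laplacian on Z: this is the kernel obtained from the semigroup
   formula 1 / Gamma(-beta/2) * \int_0^oo (u - e^(t Delta) u) dt/t^(1+beta/2). *)
Definition frac_kernel {R : realType} (beta : R) (j : int) : R :=
  if j == 0 then 0 else
  (4 `^ (beta / 2) * Gamma ((1 + beta) / 2) * Gamma (`|j|%N%:R - beta / 2)) /
  (Num.sqrt pi * `|Gamma (- (beta / 2))|
     * Gamma (`|j|%N%:R + 1 + beta / 2)).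

(* Main.v *)
Require Import Defs.
From mathcomp Require Import all_boot all_order all_algebra.
From mathcomp Require Import all_classical all_reals all_analysis.
From mathcomp Require Import measurable_realfun.
From mathcomp Require Import ring lra.

(** The kernel of - (- Delta)^(beta / 2) decays like |j|^(-1-beta) with
    beta < 2, so its second moment is infinite, and this alone excludes
    CD(0,d): [CD0_fails_of_infinite_second_moment] shows that any nonnegative
    summable kernel k on Z with sum_j k(j) j^2 = oo fails CD(0,d) for all d.

    The test functions are built from the waves w(j) = 1 - cos (theta j).
    Since w(j) = |e^(i theta j) - 1|^2 / 2, and since the mixed difference
    w(j+l) - w(j) - w(l) + w(0) is the real part of
    - (e^(i theta j) - 1) (e^(i theta l) - 1), its square is at most
    4 w(j) w(l) ([mixed_difference_cosine_wave]); summing over j and l gives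
    Gamma_2(w)(0) <= (L w(0))^2. The normalized wave v = w / L w(0) therefore
    satisfies L v(0) = 1 and Gamma_2(v)(0) <= 1 for every theta. When theta
    tends to 0, w(j) is of order theta^2 j^2 for each fixed j, whereas
    L w(0) / theta^2 tends to infinity because the second moment is infinite;
    hence v tends to 0 pointwise ([spread_out_wave]). Bounded energy and
    pointwise convergence to 0 make a wave of low frequency almost orthogonal,
    for the quadratic form Gamma_2, to any given function of finite energy
    ([add_almost_orthogonal_wave]). Adding n such waves one after the other
    gives a bounded function u with L u(0) = n and Gamma_2(u)(0) = O(n), which
    contradicts Gamma_2(u) >= (L u)^2 / d for large n.

    It remains to see that the fractional kernel is summable with infinite
    second moment. Only the functional equation Gamma (x + 1) = x Gamma x and
    the positivity of Gamma on the positive reals enter. Both come from the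
    fundamental theorem of calculus for t^x e^(-t), whose derivative
    (x - t) t^(x-1) e^(-t) changes sign at t = x
    ([integral_euler_recurrence]). The functional equation gives
    (n + 1 + beta / 2) k(n+1) = (n - beta / 2) k(n), from which summability
    follows by telescoping and k(n) n^2 >= c / n by a monotonicity argument
    ([gamma_quotient_sum_le], [gamma_quotient_ge]). *)

Set Implicit Arguments.
Unset Strict Implicit.
Unset Printing Implicit Defensive.

Import Order.TTheory GRing.Theory Num.Theory.
Import numFieldNormedType.Exports.

Local Open Scope classical_set_scope.
Local Open Scope ring_scope.

(** * Sums of nonnegative families *)

Section esum_complements.
Context {R : realType} {T : choiceType}.
Implicit Types (f : T -> \bar R) (c : R).

Lemma esumZl_le c f : 0 <= c -> (forall i, 0 <= f i)%E ->
  (\esum_(i in [set: T]) (c%:E * f i) <= c%:E * \esum_(i in [set: T]) f i)%E.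
Proof.
move=> c0 f0; apply: ge_ereal_sup => _ [X [finX _] <-].
rewrite -ge0_mule_fsumr//; apply: lee_wpmul2l; first by rewrite lee_fin.
by apply: ereal_sup_ubound; exists X.
Qed.

Lemma esumZl c f : 0 <= c -> (forall i, 0 <= f i)%E ->
  (\esum_(i in [set: T]) (c%:E * f i) = c%:E * \esum_(i in [set: T]) f i)%E.
Proof.
move=> c0 f0; apply/eqP; rewrite eq_le esumZl_le//=.
have [->|c_neq0] := eqVneq c 0.
  by rewrite mul0e esum_ge0// => i _; rewrite mul0e.
have {}c0 : 0 < c by rewrite lt_neqAle eq_sym c_neq0.
rewrite -lee_pdivlMl//.
(* The converse inequality is the direct one for c^-1 and c * f. *)
under [leLHS]eq_esum => i _.
  rewrite -[f i]mul1e -(@mulVf _ c) ?gt_eqF// EFinM -muleA.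
  over.
apply: esumZl_le; first by rewrite invr_ge0 ltW.
by move=> i; rewrite mule_ge0// lee_fin ltW.
Qed.

(** The finite sets on which the supremum defining a finite sum is almost
    attained leave a small remainder. *)
Lemma esum_small_tail f (eta : R) : (forall i, 0 <= f i)%E ->
  (\esum_(i in [set: T]) f i < +oo)%E -> 0 < eta ->
  exists2 F : set T, finite_set F &
    (\esum_(i in [set: T]) (if i \in F then 0 else f i) <= eta%:E)%E.
Proof.
move=> f0 foo eta0.
have fin : \esum_(i in [set: T]) f i \is a fin_num.
  by rewrite ge0_fin_numE// esum_ge0.
have : (\esum_(i in [set: T]) f i - eta%:E < \esum_(i in [set: T]) f i)%E.
  by rewrite lteBlDr// lteDl// lte_fin.
move=> /ereal_sup_gt[_ [F [finF _] <-]] hF; exists F => //.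
have split_f : (\esum_(i in [set: T]) f i =
    \esum_(i in F) f i + \esum_(i in ~` F) f i)%E.
  by rewrite (esumID F)// setTI setTI.
have tailE : (\esum_(i in [set: T]) (if i \in F then 0 else f i) =
              \esum_(i in ~` F) f i)%E.
  rewrite [RHS]esum_mkcond; apply: eq_esum => i _.
  by rewrite in_setC; case: (i \in F).
have finF' : \esum_(i in F) f i \is a fin_num.
  rewrite ge0_fin_numE ?esum_ge0//; apply: le_lt_trans foo.
  by rewrite split_f leeDl// esum_ge0.
move: hF; rewrite tailE split_f -esum_fset//.
rewrite lteBlDr// lteD2lE//; exact: ltW.
Qed.

End esum_complements.

(** * Cosine near the origin *)

Section cosine_bounds.
Context {R : realType}.
Implicit Type x : R.

Lemma sin_mean_value x : 0 < x -> exists2 c, 0 < c < x & sin x = cos c * x.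
Proof.
move=> x0.
have [|c] := @MVT R (@sin R) cos 0 x x0.
  by apply: continuous_subspaceT => y; exact: continuous_sin.
by rewrite in_itv/= sin0 !subr0; exists c.
Qed.

Lemma one_sub_cosE x : 1 - cos x = 2 * sin (x / 2) ^+ 2.
Proof.
rewrite {1}(_ : x = (x / 2) *+ 2); last by rewrite -mulr_natr divfK.
by rewrite cos_mulr2n cos2sin2; ring.
Qed.

Lemma one_sub_cos_le x : 1 - cos x <= x ^+ 2 / 2.
Proof.
rewrite -cos_norm -[x ^+ 2]real_normK ?num_real//.
move: `|x| (normr_ge0 x) => {x} x; rewrite le_eqVlt => /predU1P[<-|x0].
  by rewrite cos0 subrr expr0n/= mul0r.
have [|c _ E] := @sin_mean_value (x / 2); first by rewrite divr_gt0.
rewrite one_sub_cosE E exprMn.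
have : cos c ^+ 2 <= 1 by rewrite cos2sin2 gerBl sqr_ge0.
have : 0 <= (x / 2) ^+ 2 by exact: sqr_ge0.
nra.
Qed.

Lemma one_sub_cos_ge x : `|x| <= 1 -> x ^+ 2 / 4 <= 1 - cos x.
Proof.
rewrite -cos_norm -[x ^+ 2]real_normK ?num_real//.
move: `|x| (normr_ge0 x) => {x} x; rewrite le_eqVlt => /predU1P[<- _|x0 x1].
  by rewrite cos0 subrr expr0n/= mul0r.
have [|c /andP[c0 cx] E] := @sin_mean_value (x / 2); first by rewrite divr_gt0.
rewrite one_sub_cosE E exprMn.
(* Here 0 < c < 1 / 2, so that cos c >= 1 - c^2 / 2 >= 7 / 8. *)
have c78 : 7 / 8 <= cos c by have := one_sub_cos_le c; nra.
have : 49 / 64 <= cos c ^+ 2 by nra.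
have : 0 <= (x / 2) ^+ 2 by exact: sqr_ge0.
nra.
Qed.

End cosine_bounds.

(** * Kernels with infinite second moment *)

(** Young's inequality with the small weight on a inside F and on b outside. *)
Lemma sqrD_le_split (R : realFieldType) (F : bool) (delta a b : R) :
  0 < delta ->
  (a + b) ^+ 2 <= (1 + delta) * (a ^+ 2 + b ^+ 2) +
    delta^-1 * ((if F then 0 else a ^+ 2) + (if F then b ^+ 2 else 0)).
Proof.
move=> d0; have E : delta^-1 * delta = 1 by rewrite mulVf// gt_eqF.
have i0 : 0 < delta^-1 by rewrite invr_gt0.
case: F; rewrite -subr_ge0.
  rewrite [leRHS](_ : _ = delta^-1 * (delta * a - b) ^+ 2 + delta * b ^+ 2 +
    (1 - delta^-1 * delta) * (delta * a ^+ 2 - 2 * a * b)); last by ring.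
  by rewrite E subrr mul0r addr0 addr_ge0// mulr_ge0 ?sqr_ge0// ltW.
rewrite [leRHS](_ : _ = delta^-1 * (delta * b - a) ^+ 2 + delta * a ^+ 2 +
  (1 - delta^-1 * delta) * (delta * b ^+ 2 - 2 * a * b)); last by ring.
by rewrite E subrr mul0r addr0 addr_ge0// mulr_ge0 ?sqr_ge0// ltW.
Qed.

Section heavy_tails.
Context {R : realType} (k : int -> R).
Hypothesis k_ge0 : forall j, 0 <= k j.

Definition mixed_difference (u : int -> R) (p : int * int) : R :=
  u (p.1 + p.2) - u p.1 - u p.2 + u 0.

Definition energy (u : int -> R) : \bar R :=
  \esum_(p in [set: int * int])
    (k p.1 * k p.2 * mixed_difference u p ^+ 2)%:E.

(** For u >= 0 with u 0 = 0 this is the value at 0 of the nonlocal operator;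
    as a sum of nonnegative terms it is additive without any summability
    condition. *)
Definition mass (u : int -> R) : \bar R :=
  \esum_(j in [set: int]) (k j * u j)%:E.

Lemma Gamma2_0 u : Gamma2 k u 0 = ((4^-1)%:E * energy u)%E.
Proof.
congr (_ * _)%E; apply: eq_esum => p _.
by rewrite /mixed_difference !add0r.
Qed.

Lemma mass_ge0 u : (forall j, 0 <= u j) -> (0 <= mass u)%E.
Proof. by move=> u0; apply: esum_ge0 => j _; rewrite lee_fin mulr_ge0. Qed.

Lemma nonlocal_op_0 u : (forall j, 0 <= u j) -> u 0 = 0 ->
  nonlocal_op k u 0 = fine (mass u).
Proof.
move=> u_ge0 u00; rewrite /nonlocal_op /zsum.
have E j : k j * (u (0 + j) - u 0) = k j * u j by rewrite u00 subr0 add0r.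
rewrite [X in _ - fine X]esum1 ?subr0; last first.
  move=> j _; rewrite funenegE/= E -EFin_max; congr (_%:E).
  by apply/max_idPr; rewrite oppr_le0 mulr_ge0.
congr fine; apply: eq_esum => j _.
rewrite funeposE/= E -EFin_max; congr (_%:E).
by apply/max_idPl; rewrite mulr_ge0.
Qed.

Lemma massD u v : (forall j, 0 <= u j) -> (forall j, 0 <= v j) ->
  mass (fun j => u j + v j) = (mass u + mass v)%E.
Proof.
move=> u0 v0; rewrite /mass -esumD; last 2 first.
- by move=> j _; rewrite lee_fin mulr_ge0.
- by move=> j _; rewrite lee_fin mulr_ge0.
by apply: eq_esum => j _; rewrite mulrDr EFinD.
Qed.

Lemma massZ c u : 0 <= c -> (forall j, 0 <= u j) ->
  mass (fun j => c * u j) = (c%:E * mass u)%E.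
Proof.
move=> c0 u0; rewrite /mass -esumZl//; last first.
  by move=> j; rewrite lee_fin mulr_ge0.
by apply: eq_esum => j _; rewrite -EFinM mulrCA.
Qed.

(** Factorizing the sum over pairs turns the pointwise bound on the mixed
    differences of a wave into a bound of its energy by the square of its
    mass. *)
Lemma mass_mass u : (forall j, 0 <= u j) -> (mass u < +oo)%E ->
  \esum_(p in [set: int * int]) (k p.1 * u p.1 * (k p.2 * u p.2))%:E
  = (mass u * mass u)%E.
Proof.
move=> u0 muoo; have ku j : 0 <= k j * u j by rewrite mulr_ge0.
have muE : mass u = (fine (mass u))%:E.
  by rewrite fineK// ge0_fin_numE// mass_ge0.
have -> : [set: int * int] = [set: int] `*`` (fun=> [set: int]).
  by apply/seteqP; split.
rewrite -(@esum_esum _ _ _ _ _ (fun i j => (k i * u i * (k j * u j))%:E));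
  last by move=> i j; rewrite lee_fin mulr_ge0.
under eq_esum => i _.
  under eq_esum => j _ do rewrite EFinM.
  rewrite esumZl// -/(mass u) muE muleC.
  over.
by rewrite esumZl ?fine_ge0 ?mass_ge0// -/(mass u) -muE.
Qed.

Definition cosine_wave (theta : R) (j : int) : R := 1 - cos (theta * j%:~R).

Lemma cosine_wave_ge0 theta j : 0 <= cosine_wave theta j.
Proof. by rewrite subr_ge0 cos_le1. Qed.

Lemma cosine_wave_le2 theta j : cosine_wave theta j <= 2.
Proof. by have := cos_geN1 (theta * j%:~R); rewrite /cosine_wave; lra. Qed.

Lemma cosine_wave0 theta : cosine_wave theta 0 = 0.
Proof. by rewrite /cosine_wave mulr0 cos0 subrr. Qed.

(** With z = e^(i theta j) and w = e^(i theta l), the mixed difference is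
    - Re ((z - 1) (w - 1)), whereas |z - 1|^2 is twice the cosine wave. *)
Lemma mixed_difference_cosine_wave theta p :
  mixed_difference (cosine_wave theta) p ^+ 2 <=
  4 * (cosine_wave theta p.1 * cosine_wave theta p.2).
Proof.
rewrite /mixed_difference cosine_wave0 /cosine_wave rmorphD/= mulrDr cosD.
set a := theta * p.1%:~R; set b := theta * p.2%:~R.
have := cos2Dsin2 a; have := cos2Dsin2 b.
move: (cos a) (sin a) (cos b) (sin b) => c' s' c s E E'.
rewrite -subr_ge0.
suff -> : 4 * ((1 - c') * (1 - c)) -
    (1 - (c' * c - s' * s) - (1 - c') - (1 - c) + 0) ^+ 2 =
    ((1 - c') * s + s' * (1 - c)) ^+ 2 by exact: sqr_ge0.
have -> : (1 - (c' * c - s' * s) - (1 - c') - (1 - c) + 0) =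
  - ((1 - c') * (1 - c) - s' * s) by ring.
have Es : s ^+ 2 = 1 - c ^+ 2 by rewrite -E; ring.
have Es' : s' ^+ 2 = 1 - c' ^+ 2 by rewrite -E'; ring.
transitivity (4 * ((1 - c') * (1 - c)) - ((1 - c') ^+ 2 * (1 - c) ^+ 2
  - 2 * (1 - c') * (1 - c) * s' * s + s' ^+ 2 * s ^+ 2)); first by ring.
transitivity ((1 - c') ^+ 2 * s ^+ 2 + 2 * (1 - c') * (1 - c) * s' * s +
  s' ^+ 2 * (1 - c) ^+ 2); last by ring.
by rewrite Es Es'; ring.
Qed.

Hypothesis k_summable : (\esum_(j in [set: int]) (k j)%:E < +oo)%E.

Lemma mass_bounded_lt_pinfty (M : R) u : 0 <= M ->
  (forall j, u j <= M) -> (mass u < +oo)%E.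
Proof.
move=> M0 uM.
apply: (@le_lt_trans _ _ (M%:E * \esum_(j in [set: int]) (k j)%:E)%E).
  rewrite -esumZl//; apply: le_esum => j _.
  by rewrite -EFinM lee_fin mulrC ler_wpM2r.
by rewrite lte_mul_pinfty// lee_fin.
Qed.

Hypothesis k_moment :
  (\esum_(j in [set: int]) (k j * j%:~R ^+ 2)%:E = +oo)%E.

(** On a finite set of j and for theta small, 1 - cos (theta j) is comparable
    to (theta j)^2; the infinite second moment thus makes the mass of the wave
    much larger than theta^2. *)
Lemma mass_cosine_wave_large (A : R) :
  exists2 theta, 0 < theta &
    ((A * theta ^+ 2)%:E <= mass (cosine_wave theta))%E.
Proof.
have : ((4 * A)%:E < \esum_(j in [set: int]) (k j * j%:~R ^+ 2)%:E)%E.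
  by rewrite k_moment ltry.
move=> /ereal_sup_gt[_ [X [finX _] <-]] AX.
(* At frequency 1 / N all the phases theta j with j in X are at most 1. *)
pose N : R := 1 + \sum_(j \in X) `|j%:~R : R|.
have sum_ge0 : 0 <= \sum_(j \in X) `|j%:~R : R| by apply: fsumr_ge0.
have N0 : 0 < N by rewrite /N; lra.
have jN j : X j -> `|j%:~R : R| <= N.
  move=> Xj; rewrite /N (fsbigD1 j)//= addrCA ler_wpDr// addr_ge0//.
  exact: fsumr_ge0.
exists N^-1; first by rewrite invr_gt0.
apply: (@le_trans _ _ (((N^-1) ^+ 2 / 4)%:E *
    \sum_(j \in X) (k j * j%:~R ^+ 2)%:E)%E).
  have t2 : 0 < N^-1 ^+ 2 / 4 by rewrite divr_gt0// exprn_gt0// invr_gt0.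
  rewrite -lee_pdivrMl// -EFinM; apply: ltW; apply: le_lt_trans AX.
  rewrite lee_fin le_eqVlt; apply/orP; left; apply/eqP; field.
  by rewrite gt_eqF.
rewrite ge0_mule_fsumr; last first.
  by move=> j; rewrite lee_fin mulr_ge0// sqr_ge0.
apply: esum_ge; exists X => //; apply: lee_fsum => // j Xj.
rewrite -EFinM lee_fin mulrCA ler_wpM2l//.
apply: le_trans (one_sub_cos_ge _); last first.
  by rewrite normrM normfV (gtr0_norm N0) mulrC ler_pdivrMr// mul1r jN.
by rewrite exprMn; lra.
Qed.

Lemma mixed_differenceD u v p :
  mixed_difference (fun j => u j + v j) p =
  mixed_difference u p + mixed_difference v p.
Proof. by rewrite /mixed_difference; ring. Qed.

Lemma mixed_differenceZ c u p :
  mixed_difference (fun j => c * u j) p = c * mixed_difference u p.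
Proof. by rewrite /mixed_difference; ring. Qed.

(** At low frequency the normalized wave has mass 1 and energy at most 4, but
    it is pointwise as small as desired. *)
Lemma spread_out_wave (A : R) : 0 < A -> exists v : int -> R,
  [/\ forall j, 0 <= v j, exists M, forall j, v j <= M, v 0 = 0, mass v = 1%E
    & [/\ (energy v <= 4%:E)%E, forall j, v j <= j%:~R ^+ 2 / A
    & forall p, mixed_difference v p ^+ 2 <= 4 * (v p.1 * v p.2)]].
Proof.
move=> A0; have [theta theta0 Am] := mass_cosine_wave_large A.
set w := cosine_wave theta in Am *.
have w0 j : 0 <= w j by exact: cosine_wave_ge0.
have moo : (mass w < +oo)%E.
  by apply: (@mass_bounded_lt_pinfty 2) => // j; exact: cosine_wave_le2.
have mE : mass w = (fine (mass w))%:E.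
  by rewrite fineK// ge0_fin_numE// mass_ge0.
move: Am; rewrite mE lee_fin; set m := fine _ => Am.
have m0 : 0 < m by apply: lt_le_trans Am; rewrite mulr_gt0// exprn_gt0.
have v0 j : 0 <= m^-1 * w j by rewrite mulr_ge0// invr_ge0 ltW.
have mv : mass (fun j => m^-1 * w j) = 1%E.
  by rewrite massZ ?invr_ge0 ?ltW// mE -EFinM mulVf// gt_eqF.
have vD p : mixed_difference (fun j => m^-1 * w j) p ^+ 2 <=
    4 * (m^-1 * w p.1 * (m^-1 * w p.2)).
  rewrite mixed_differenceZ exprMn.
  rewrite (_ : 4 * _ = m^-1 ^+ 2 * (4 * (w p.1 * w p.2))); last by ring.
  by rewrite ler_wpM2l ?sqr_ge0// mixed_difference_cosine_wave.
exists (fun j => m^-1 * w j); split=> //.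
- exists (m^-1 * 2) => j.
  by rewrite ler_pM2l ?invr_gt0// cosine_wave_le2.
- by rewrite /w cosine_wave0 mulr0.
split=> //.
- have -> : 4%:E = (4%:E * (mass (fun j => (m^-1 * w j)%R) *
      mass (fun j => (m^-1 * w j)%R)))%E by rewrite mv !mule1.
  rewrite -mass_mass ?mv ?ltry//.
  rewrite -esumZl//; last first.
    by move=> p; rewrite lee_fin; apply: mulr_ge0; exact: mulr_ge0.
  apply: le_esum => p _; rewrite -EFinM lee_fin.
  rewrite [leRHS](_ : _ =
    k p.1 * k p.2 * (4 * (m^-1 * w p.1 * (m^-1 * w p.2)))); last by ring.
  by rewrite ler_wpM2l// mulr_ge0.
- move=> j; have wj : w j <= theta ^+ 2 * j%:~R ^+ 2.
    apply: le_trans (one_sub_cos_le _) _; rewrite exprMn.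
    by rewrite ler_pdivrMr// ler_peMr ?ler1n// mulr_ge0// sqr_ge0.
  rewrite mulrC ler_pdivrMr// mulrAC ler_pdivlMr//.
  have j2 : 0 <= (j%:~R : R) ^+ 2 by exact: sqr_ge0.
  apply: le_trans (ler_wpM2r (ltW A0) wj) _.
  by rewrite mulrAC [leRHS]mulrC ler_wpM2r// mulrC.
Qed.

(** A spread-out wave is almost orthogonal to u for the energy: most of the
    energy of u sits on a finite set of pairs, where the wave is tiny. *)
Lemma add_almost_orthogonal_wave (u : int -> R) (q : R) :
  0 <= q -> (energy u <= q%:E)%E ->
  exists v : int -> R,
  [/\ forall j, 0 <= v j, exists M, forall j, v j <= M, v 0 = 0, mass v = 1%E
    & (energy (fun j => (u j + v j)%R) <= (q + 6)%:E)%E].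
Proof.
move=> q0 uq.
pose P p := k p.1 * k p.2; have P0 p : 0 <= P p by rewrite mulr_ge0.
(* 4 bounds the energy of the wave: delta (q + 4) = 1, and the two remainders
   weighted by delta^-1 are at most delta / 2 each; in total q + 4 + 1 + 1. *)
pose delta := (q + 4)^-1; have d0 : 0 < delta by rewrite invr_gt0; lra.
have d20 : 0 < delta / 2 by rewrite divr_gt0.
have [||F finF Ftail] := @esum_small_tail R (int * int)%type
    (fun p => (P p * mixed_difference u p ^+ 2)%:E) (delta / 2) _ _ d20.
- by move=> p; rewrite lee_fin mulr_ge0// sqr_ge0.
- exact: le_lt_trans uq (ltry _).
pose W := \sum_(p \in F) (P p * (4 * (p.1%:~R ^+ 2 * p.2%:~R ^+ 2)) : R).
have Pjl0 p : 0 <= P p * (4 * (p.1%:~R ^+ 2 * p.2%:~R ^+ 2)).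
  by rewrite mulr_ge0// mulr_ge0// mulr_ge0// sqr_ge0.
have W0 : 0 <= W by apply: fsumr_ge0.
(* On F the squared mixed difference of the wave is at most
   4 j^2 l^2 / A^2 <= 4 j^2 l^2 / A, which sums to at most W / A. *)
pose A := 1 + W / (delta / 2).
have A1 : 1 <= A by rewrite lerDl divr_ge0// ltW.
have A0 : 0 < A by exact: lt_le_trans A1.
have [v [v0 vM v00 mv [ev vA vD]]] := spread_out_wave A0.
exists v; split=> //.
pose fu p := (P p * mixed_difference u p ^+ 2)%:E.
pose fv p := (P p * mixed_difference v p ^+ 2)%:E.
have fu0 p : (0 <= fu p)%E by rewrite lee_fin mulr_ge0// sqr_ge0.
have fv0 p : (0 <= fv p)%E by rewrite lee_fin mulr_ge0// sqr_ge0.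
have Fv : (\esum_(p in [set: int * int]) (if p \in F then fv p else 0)
    <= (delta / 2)%:E)%E.
  rewrite -esum_mkcond esum_fset//.
  apply: (@le_trans _ _ (\sum_(p \in F)
      (A^-1)%:E * (P p * (4 * (p.1%:~R ^+ 2 * p.2%:~R ^+ 2)))%:E)%E).
    apply: lee_fsum => // p _; rewrite -EFinM lee_fin [leRHS]mulrCA ler_wpM2l//.
    apply: le_trans (vD p) _.
    rewrite [leRHS]mulrCA ler_wpM2l//.
    apply: le_trans (ler_pM (v0 _) (v0 _) (vA p.1) (vA p.2)) _.
    rewrite mulf_div [leRHS]mulrC ler_wpM2l//.
      by apply: mulr_ge0; exact: sqr_ge0.
    by rewrite lef_pV2 ?posrE ?mulr_gt0// ler_peMr// ltW.
  rewrite -ge0_mule_fsumr; last by move=> p; rewrite lee_fin.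
  rewrite fsumEFin// -EFinM lee_fin mulrC ler_pdivrMr// -/W.
  by rewrite /A mulrDr mulr1 mulrCA divff ?mulr1 ?lerDr ?ltW// gt_eqF.
have -> : (q + 6)%:E = ((1 + delta)%:E * (q%:E + 4%:E) +
    delta^-1%:E * ((delta / 2)%:E + (delta / 2)%:E))%E.
  have E : q + 6 = (1 + delta) * (q + 4) + delta^-1 * (delta / 2 + delta / 2).
    by rewrite /delta; field; lra.
  by rewrite E.
apply: (@le_trans _ _ ((1 + delta)%:E * (energy u + energy v) + delta^-1%:E *
   (\esum_(p in [set: int * int]) (if p \in F then 0 else fu p) +
    \esum_(p in [set: int * int]) (if p \in F then fv p else 0)))%E);
  last first.
  apply: leeD; apply: lee_wpmul2l.
  - by rewrite lee_fin addr_ge0// ltW.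
  - exact: leeD.
  - by rewrite lee_fin invr_ge0 ltW.
  - exact: leeD.
have gu0 p : (0 <= (if p \in F then 0 else fu p))%E by case: ifP.
have gv0 p : (0 <= (if p \in F then fv p else 0))%E by case: ifP.
rewrite /energy -!esumD//; last 2 first.
- by move=> p _; exact: fu0.
- by move=> p _; exact: fv0.
have d1_ge0 : 0 <= 1 + delta by rewrite addr_ge0// ltW.
have dV_ge0 : 0 <= delta^-1 by rewrite invr_ge0 ltW.
have fuv0 p : (0 <= fu p + fv p)%E by rewrite adde_ge0.
have guv0 p : (0 <= (if p \in F then 0 else fu p) +
    (if p \in F then fv p else 0))%E by rewrite adde_ge0.
rewrite -!esumZl// -esumD//; last 2 first.
- by move=> p _; apply: mule_ge0; [rewrite lee_fin|exact: fuv0].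
- by move=> p _; apply: mule_ge0; [rewrite lee_fin|exact: guv0].
apply: le_esum => p _; rewrite mixed_differenceD.
set a := mixed_difference u p; set b := mixed_difference v p.
have : P p * (a + b) ^+ 2 <= (1 + delta) * (P p * a ^+ 2 + P p * b ^+ 2) +
    delta^-1 * ((if p \in F then 0 else P p * a ^+ 2) +
                (if p \in F then P p * b ^+ 2 else 0)).
  apply: le_trans (ler_wpM2l (P0 p) (sqrD_le_split (p \in F) a b d0)) _.
  by rewrite le_eqVlt; case: ifP => _; apply/orP; left; apply/eqP; ring.
by rewrite -lee_fin; case: ifP.
Qed.

(** Almost orthogonality makes the energies of n successive waves add up, just
    like their masses. *)
Lemma large_mass_small_energy (n : nat) : exists u : int -> R,
  [/\ forall j, 0 <= u j, exists M, forall j, u j <= M, u 0 = 0,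
    mass u = n%:R%:E & (energy u <= (6 * n%:R)%:E)%E].
Proof.
elim: n => [|n [u [u0 [M uM] u00 mu eu]]].
  exists (fun=> 0); split=> //; first by exists 0.
    by apply: esum1 => j _; rewrite mulr0.
  rewrite mulr0 /energy esum1// => p _.
  by rewrite /mixed_difference !subr0 addr0 expr0n/= mulr0.
have q0 : 0 <= 6 * n%:R :> R by rewrite mulr_ge0.
have [v [v0 [M' vM] v00 mv euv]] := add_almost_orthogonal_wave q0 eu.
exists (fun j => u j + v j); split.
- by move=> j; rewrite addr_ge0.
- by exists (M + M') => j; exact: lerD.
- by rewrite u00 v00 addr0.
- by rewrite massD// mu mv -EFinD natr1.
- by rewrite -[n.+1%:R]natr1 mulrDr mulr1.
Qed.

(** A function of mass n and energy at most 6 n violates the inequality at 0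
    as soon as n^2 / d > 6 n / 4. *)
Theorem CD0_fails_of_infinite_second_moment (d : R) : 0 < d -> ~ CD0 k d.
Proof.
move=> d0 cd.
pose n := (Num.truncn (2 * d)).+1.
have dn : 2 * d < n%:R by rewrite /n; apply: truncnS_gt.
have [u [u0 [M uM] u00 mu eu]] := large_mass_small_energy n.
have M0 : 0 <= M by apply: le_trans (uM 0); rewrite u00.
have adm : admissible k u 0.
  rewrite /admissible; under eq_esum => j _ do rewrite add0r ger0_norm//.
  exact: mass_bounded_lt_pinfty uM.
have := cd 0 u adm; rewrite nonlocal_op_0// mu/= Gamma2_0.
apply/negP; rewrite -ltNge.
apply: (@le_lt_trans _ _ ((4^-1)%:E * (6 * n%:R)%:E)%E).
  by rewrite lee_wpmul2l// lee_fin invr_ge0.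
have n0 : 0 < n%:R :> R by rewrite ltr0n.
have nd : 2 < n%:R / d by rewrite ltr_pdivlMr.
rewrite -!EFinM lte_fin [ltRHS](_ : _ = n%:R * (n%:R / d)); last by ring.
by move: (n%:R / d) nd => z z2; nra.
Qed.

End heavy_tails.

(** * Euler's integral *)

Section fundamental_theorem_open_left.
Context {R : realType}.
Notation mu := (@lebesgue_measure R).
Implicit Types (f F : R -> R) (a b : R).

(** Both the integrand and the derivative of the primitive may blow up at the
    left end: the integral over ]a, b] is the monotone limit of the integrals
    over the compact intervals [a + (b - a) / (n + 2), b]. *)
Lemma ge0_integral_itvoc_FTC2 f F a b : a < b ->
  (forall t, a < t <= b -> 0 <= f t) ->
  (forall t, a < t -> {for t, continuous f}) ->
  (forall t, a < t -> is_derive t 1 F (f t)) ->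
  F t @[t --> a^'+] --> F a ->
  (\int[mu]_(t in `]a, b]) (f t)%:E = (F b - F a)%:E)%E.
Proof.
move=> ab f0 cf dF Fa.
(* The shift n.+2 keeps e n strictly below b. *)
pose e n : R := a + (b - a) / n.+2%:R.
have ba0 : 0 < b - a by rewrite subr_gt0.
have ae n : a < e n by rewrite ltrDl divr_gt0.
have eb n : e n < b.
  by rewrite -ltrBrDl ltr_pdivrMr// ltr_pMr// ltr1n.
have ea : e n @[n --> \oo] --> a.
  rewrite -[X in _ --> X]addr0; apply: cvgD; first exact: cvg_cst.
  rewrite -(mulr0 (b - a)); apply: cvgMr.
  have := @cvg_harmonic R; rewrite -(cvg_shiftn 1)/=.
  by under eq_fun do rewrite addn1.
have cF t : a < t -> {for t, continuous F}.
  move=> at_; have [dFt _] := dF t at_.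
  exact/differentiable_continuous/derivable1_diffP.
have Eab : `]a, b]%classic = \bigcup_n `[e n, b]%classic.
  apply/seteqP; split => t /=; rewrite in_itv/=.
    move=> /andP[at_ tb].
    have : \forall n \near \oo, e n < t by exact: (cvgr_lt a).
    move=> [n _ /(_ n (leqnn n)) ent]; exists n => //=.
    by rewrite in_itv/= tb ltW.
  by move=> [n _]/=; rewrite in_itv/= => /andP[/(lt_le_trans (ae n)) -> ->].
have If n : (\int[mu]_(t in `[e n, b]) (f t)%:E = (F b - F (e n))%:E)%E.
  rewrite EFinB; apply: continuous_FTC2 => //.
  - apply: continuous_in_subspaceT => t /[!inE]/=.
    by rewrite in_itv/= => /andP[et _]; exact/cf/(lt_le_trans (ae n)).
  - split.
    + move=> t; rewrite in_itv/= => /andP[et _].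
      by have [] := dF t (lt_trans (ae n) et).
    + exact/cvg_at_right_filter/cF.
    + exact/cvg_at_left_filter/cF.
  - move=> t; rewrite in_itv/= => /andP[et _]; rewrite derive1E.
    by have [_ ->] := dF t (lt_trans (ae n) et).
have H : (\int[mu]_(t in `[e n, b]) (f t)%:E)%E @[n --> \oo]
    --> (\int[mu]_(t in `]a, b]) (f t)%:E)%E.
  have := @ge0_nondecreasing_set_cvg_integral _ (measurableTypeR R) R
    (fun n => `[e n, b]%classic) (EFin \o f) (@lebesgue_measure R).
  rewrite -Eab; apply => //.
  - move=> m n mn; apply/subsetPset => t /=; rewrite !in_itv/= => /andP[emt ->].
    rewrite andbT; apply: le_trans emt; rewrite lerD2l ler_pM2l//.
    by rewrite lef_pV2 ?posrE// ler_nat.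
  - move=> n; apply/measurable_EFinP.
    apply: subspace_continuous_measurable_fun => //.
    apply: continuous_in_subspaceT => t /[!inE]/=.
    by rewrite in_itv/= => /andP[et _]; exact/cf/(lt_le_trans (ae n)).
  - move=> n t /=; rewrite in_itv/= lee_fin => /andP[et tb]; apply: f0.
    by rewrite tb (lt_le_trans (ae n)).
apply: cvg_unique H _ => //.
rewrite /=; under eq_cvg do rewrite If.
apply: cvg_EFin; first exact: nearW.
apply: cvgB; first exact: cvg_cst.
by apply: (proj1 (cvg_at_rightP F a (F a)) Fa); split.
Qed.

End fundamental_theorem_open_left.

Section euler_integral_theory.
Context {R : realType}.
Notation mu := (@lebesgue_measure R).
Implicit Types (x t : R).

Definition euler_integrand x t : R := t `^ (x - 1) * expR (- t).

(** For x > 0 the function t^x e^(-t) vanishes at 0 and at infinity, and its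
    derivative (x - t) t^(x-1) e^(-t) changes sign only at t = x. *)
Definition euler_primitive x t : R := t `^ x * expR (- t).

Lemma euler_integrand_ge0 x t : 0 <= euler_integrand x t.
Proof. by rewrite mulr_ge0 ?powR_ge0 ?expR_ge0. Qed.

Lemma euler_integrandS x t : 0 < x -> 0 < t ->
  euler_integrand (x + 1) t = t * euler_integrand x t.
Proof.
move=> x0 t0; rewrite /euler_integrand addrK mulrA.
by rewrite mulr_powRB1// ltW.
Qed.

Lemma euler_integrand_continuous x t : 0 < t ->
  {for t, continuous (euler_integrand x)}.
Proof.
move=> t0; have cP : {for t, continuous (fun s => s `^ (x - 1))}.
  apply/differentiable_continuous/derivable1_diffP.
  by apply: derivable_powR; rewrite in_itv/= t0.
apply: cvgM; first exact: cP.
by apply: continuous_comp; [exact: oppr_continuous|exact: continuous_expR].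
Qed.

Lemma is_derive_euler_primitive x t : 0 < x -> 0 < t ->
  is_derive t 1 (euler_primitive x) ((x - t) * euler_integrand x t).
Proof.
move=> x0 t0; rewrite /euler_primitive.
have dP := is_derive1_powR x t0.
apply: is_derive_eq.
rewrite /euler_integrand -(mulr_powRB1 (ltW t0) x0) /GRing.scale/=.
ring.
Qed.

Lemma euler_primitive_cvg0 x : 0 < x ->
  euler_primitive x t @[t --> 0^'+] --> euler_primitive x 0.
Proof.
move=> x0; apply: cvgM.
  by rewrite powR0 ?gt_eqF//; exact: powR_cvg0.
apply: cvg_at_right_filter.
by apply: continuous_comp; [exact: oppr_continuous|exact: continuous_expR].
Qed.

(** From s <= e^s with s = t / (2 x), the power t^x is at most a constant
    times e^(t/2). *)
Lemma euler_primitive_le x t : 0 < x -> 0 <= t ->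
  euler_primitive x t <= (2 * x) `^ x * expR (- (t / 2)).
Proof.
move=> x0 t0; have x20 : 0 < 2 * x by rewrite mulr_gt0.
have tE : t <= 2 * x * expR (t / (2 * x)).
  rewrite -ler_pdivrMl// mulrC.
  by apply: le_trans (expR_ge1Dx _); rewrite lerDr.
have {}tE : t `^ x <= (2 * x) `^ x * expR (t / 2).
  rewrite (_ : t / 2 = t / (2 * x) * x); last by field; rewrite gt_eqF.
  rewrite expRM -powRM ?expR_ge0//; last exact: ltW.
  apply: ge0_ler_powR => //; first exact: ltW.
  by rewrite nnegrE mulr_ge0 ?expR_ge0// ltW.
rewrite /euler_primitive (_ : - (t / 2) = t / 2 + - t); last by field.
by rewrite expRD mulrA ler_wpM2r// expR_ge0.
Qed.

Lemma euler_primitive_cvgy x : 0 < x ->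
  euler_primitive x t @[t --> +oo] --> 0.
Proof.
move=> x0.
apply: (@squeeze_cvgr _ _ _ _ (fun=> 0)
  (fun t => (2 * x) `^ x * expR (- (t / 2)))); last 2 first.
- exact: cvg_cst.
- rewrite -(mulr0 ((2 * x) `^ x)); apply: cvgMr.
  apply: (@cvg_comp _ _ _ (fun t => t / 2) (fun t => expR (- t)) _ +oo).
    exact: gt0_cvgMly.
  exact: cvgr_expR.
near=> t.
have t0 : 0 <= t by near: t; exact: nbhs_pinfty_ge.
by rewrite euler_primitive_le// mulr_ge0 ?powR_ge0 ?expR_ge0.
Unshelve. all: by end_near. Qed.

Lemma measurable_euler_integrand x (D : set R) : measurable D ->
  D `<=` `]0, +oo[ -> measurable_fun D (EFin \o euler_integrand x).
Proof.
move=> mD D0.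
suff m : measurable_fun `](0 : R), +oo[ (EFin \o euler_integrand x).
  exact: measurable_funS m.
apply/measurable_EFinP; apply: open_continuous_measurable_fun => //.
move=> t /[!inE]/=; rewrite in_itv/= andbT; exact: euler_integrand_continuous.
Qed.

Lemma measurable_mul_euler_integrand (h : R -> R) x (D : set R) :
  measurable_fun [set: R] h -> measurable D -> D `<=` `]0, +oo[ ->
  measurable_fun D (fun t => (h t * euler_integrand x t)%:E).
Proof.
move=> mh mD D0; apply/measurable_EFinP; apply: measurable_funM.
  exact: measurable_funTS.
by apply/measurable_EFinP; exact: measurable_euler_integrand.
Qed.

Lemma integral_euler_below x : 0 < x ->
  (\int[mu]_(t in `]0%R, x]) ((x - t) * euler_integrand x t)%:E =
   (euler_primitive x x)%:E)%E.
Proof.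
move=> x0; transitivity (euler_primitive x x - euler_primitive x 0)%:E;
  last by rewrite {2}/euler_primitive powR0 ?gt_eqF// mul0r subr0.
apply: ge0_integral_itvoc_FTC2 => //.
- by move=> t /andP[t0 tx]; rewrite mulr_ge0 ?subr_ge0// euler_integrand_ge0.
- move=> t t0; apply: cvgM; last exact: euler_integrand_continuous.
  by apply: cvgB; [exact: cvg_cst|exact: cvg_id].
- by move=> t; exact: is_derive_euler_primitive.
- exact: euler_primitive_cvg0.
Qed.

Lemma integral_euler_above x : 0 < x ->
  (\int[mu]_(t in `]x, +oo[) ((t - x) * euler_integrand x t)%:E =
   (euler_primitive x x)%:E)%E.
Proof.
move=> x0.
have ct t : 0 < t ->
    {for t, continuous (fun s => (s - x) * euler_integrand x s)}.
  move=> t0; apply: cvgM; last exact: euler_integrand_continuous.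
  by apply: cvgB; [exact: cvg_id|exact: cvg_cst].
have dN t : 0 < t -> is_derive t 1 (fun s => - euler_primitive x s)
    ((t - x) * euler_integrand x t).
  move=> t0; have ? := is_derive_euler_primitive x0 t0.
  by apply: is_derive_eq; rewrite -mulNr opprB.
rewrite integral_itv_obnd_cbnd; last first.
  apply/measurable_EFinP; apply: open_continuous_measurable_fun => // t.
  rewrite inE/=.
  by rewrite in_itv/= andbT => xt; exact/ct/(lt_trans x0).
rewrite (@ge0_continuous_FTC2y _ _ (fun s => - euler_primitive x s) _ 0).
- by rewrite EFinN oppeK add0e.
- by move=> t xt; rewrite mulr_ge0 ?subr_ge0// euler_integrand_ge0.
- apply: continuous_in_subspaceT => t /[!inE]/=; rewrite in_itv/= andbT => xt.
  exact/ct/(lt_le_trans x0).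
- by rewrite -oppr0; apply: cvgN; exact: euler_primitive_cvgy.
- by move=> t xt; have [] := dN t (lt_trans x0 xt).
- have cx : {for x, continuous (fun s => - euler_primitive x s)}.
    apply/differentiable_continuous/derivable1_diffP.
    by have [] := dN x x0.
  exact/cvg_at_right_filter/cx.
- move=> t; rewrite in_itv/= andbT => xt; rewrite derive1E.
  by have [_ ->] := dN t (lt_trans x0 xt).
Qed.

Let Eint x (D : set R) := (\int[mu]_(t in D) (euler_integrand x t)%:E)%E.

Lemma integral_euler_split x a : 0 < a ->
  Eint x `]0%R, +oo[ = (Eint x `]0%R, a] + Eint x `]a, +oo[)%E.
Proof.
move=> a0.
have E : `]0, +oo[%classic = `]0, a]%classic `|` `]a, +oo[%classic.
  by rewrite -itv_bndbnd_setU// bnd_simp ltW.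
rewrite /Eint E ge0_integral_setU//.
- by rewrite -E; exact: measurable_euler_integrand.
- by move=> t _; rewrite lee_fin euler_integrand_ge0.
- apply/disj_setPS => y [/=]; rewrite 2!in_itv/= => /andP[_ yx] /andP[].
  by rewrite ltNge yx.
Qed.

(** By the two identities above, the integrals of t^x e^(-t) and of
    x t^(x-1) e^(-t) differ by x^x e^(-x) both below and above x, with opposite
    signs. All integrands are nonnegative, so the equality holds in the
    extended reals before any integral is known to be finite. The lower bound
    by x^x e^(-x) > 0 gives positivity. *)
Lemma integral_euler_recurrence x : 0 < x ->
  (Eint (x + 1)%R `]0%R, +oo[ = x%:E * Eint x `]0%R, +oo[)%E /\
  ((euler_primitive x x)%:E <= x%:E * Eint x `]0%R, +oo[)%E.
Proof.
move=> x0.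
have below0 : `]0, x]%classic `<=` (`](0 : R), +oo[%classic : set R).
  by apply: subset_itvl.
have above0 : `]x, +oo[%classic `<=` (`](0 : R), +oo[%classic : set R).
  by apply: subset_itvr; rewrite bnd_simp ltW.
have Ege0 y D : (0 <= Eint y D)%E.
  by apply: integral_ge0 => t _; rewrite lee_fin euler_integrand_ge0.
have below : (x%:E * Eint x `]0%R, x] =
    (euler_primitive x x)%:E + Eint (x + 1)%R `]0%R, x])%E.
  rewrite -integral_euler_below// /Eint -ge0_integralD//; last 4 first.
  - move=> t/=; rewrite in_itv/= => /andP[_ tx].
    by rewrite lee_fin mulr_ge0 ?subr_ge0// euler_integrand_ge0.
  - apply: measurable_mul_euler_integrand => //.
    by apply: measurable_funB.
  - by move=> t _; rewrite lee_fin euler_integrand_ge0.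
  - exact: measurable_euler_integrand.
  rewrite -ge0_integralZl//; last 3 first.
  - exact: measurable_euler_integrand.
  - by move=> t _; rewrite lee_fin euler_integrand_ge0.
  - by rewrite lee_fin ltW.
  apply: eq_integral => t /[!inE]/=; rewrite in_itv/= => /andP[t0 _].
  by rewrite euler_integrandS// -EFinD -EFinM; congr (_%:E); ring.
have above : (Eint (x + 1)%R `]x, +oo[ =
    (euler_primitive x x)%:E + x%:E * Eint x `]x, +oo[)%E.
  rewrite -integral_euler_above// /Eint -ge0_integralZl//; last 3 first.
  - exact: measurable_euler_integrand.
  - by move=> t _; rewrite lee_fin euler_integrand_ge0.
  - by rewrite lee_fin ltW.
  rewrite -ge0_integralD//; last 4 first.
  - move=> t/=; rewrite in_itv/= andbT => tx.
    rewrite lee_fin; apply: mulr_ge0; last exact: euler_integrand_ge0.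
    by rewrite subr_ge0 ltW.
  - apply: measurable_mul_euler_integrand => //.
    by apply: measurable_funB.
  - move=> t _; rewrite -EFinM lee_fin.
    by apply: mulr_ge0; [exact: ltW|exact: euler_integrand_ge0].
  - by apply: measurable_funeM; exact: measurable_euler_integrand.
  have E (t : R) : 0 < t -> euler_integrand (x + 1) t =
      (t - x) * euler_integrand x t + x * euler_integrand x t.
    by move=> t0; rewrite euler_integrandS//; ring.
  apply: eq_integral => t /[!inE]/=; rewrite in_itv/= andbT => xt.
  by rewrite E// (lt_trans x0).
split.
  rewrite !(@integral_euler_split _ x)// above.
  rewrite (ge0_muleDr _ (Ege0 x _) (Ege0 x _)) below.
  by rewrite addeCA addeA.
rewrite (@integral_euler_split _ x)// (ge0_muleDr _ (Ege0 x _) (Ege0 x _)).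
rewrite below -addeA leeDl//.
by rewrite adde_ge0// mule_ge0// lee_fin ltW.
Qed.

(** Near 0 the factor e^(-t) is at most 1 and t^(x-1) is integrable; beyond x
    the integrand is at most a multiple of e^(-t/2). *)
Lemma integral_euler_lt_pinfty x : 0 < x -> (Eint x `]0%R, +oo[ < +oo)%E.
Proof.
move=> x0; rewrite (integral_euler_split _ x0); apply: lte_add_pinfty.
  apply: (@le_lt_trans _ _ (\int[mu]_(t in `]0%R, x]) (t `^ (x - 1))%:E)%E).
    apply: ge0_le_integral => //.
    - by move=> t _; rewrite lee_fin euler_integrand_ge0.
    - apply: measurable_euler_integrand => //; exact: subset_itvl.
    - apply/measurable_EFinP; apply: measurable_funTS; exact: measurable_powR.
    - move=> t /=; rewrite in_itv/= lee_fin => /andP[t0 _].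
      by rewrite /euler_integrand ler_piMr ?powR_ge0// expR_le1 oppr_le0 ltW.
  have dP t : 0 < t -> is_derive t 1 (fun s => x^-1 * s `^ x) (t `^ (x - 1)).
    move=> t0; have dP := is_derive1_powR x t0.
    by apply: is_derive_eq; rewrite /GRing.scale/= mulrA mulVf ?mul1r// gt_eqF.
  suff -> : (\int[mu]_(t in `]0%R, x]) (t `^ (x - 1))%:E =
      (x^-1 * x `^ x - x^-1 * 0 `^ x)%:E)%E by rewrite ltry.
  apply: ge0_integral_itvoc_FTC2 => //.
  - by move=> t _; exact: powR_ge0.
  - move=> t t0; apply/differentiable_continuous/derivable1_diffP.
    by apply: derivable_powR; rewrite in_itv/= t0.
  - by rewrite powR0 ?gt_eqF//; apply: cvgMr; exact: powR_cvg0.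
pose C := x^-1 * (2 * x) `^ x.
have C0 : 0 <= C by rewrite mulr_ge0 ?powR_ge0// invr_ge0 ltW.
have cexp : continuous (fun t : R => C * expR (- (t / 2))).
  move=> t; apply: cvgM; first exact: cvg_cst.
  apply: (@continuous_comp _ _ _ (fun t => - (t / 2)) expR).
    by apply: cvgN; apply: cvgM; [exact: cvg_id|exact: cvg_cst].
  exact: continuous_expR.
apply: (@le_lt_trans _ _
    (\int[mu]_(t in `[x, +oo[) (C * expR (- (t / 2)))%:E)%E).
  rewrite -integral_itv_obnd_cbnd; last first.
    apply/measurable_EFinP; apply: measurable_funTS.
    exact: continuous_measurable_fun.
  apply: ge0_le_integral => //.
  - by move=> t _; rewrite lee_fin euler_integrand_ge0.
  - apply: measurable_euler_integrand => //.
    by apply: subset_itvr; rewrite bnd_simp ltW.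
  - apply/measurable_EFinP; apply: measurable_funTS.
    exact: continuous_measurable_fun.
  - move=> t /=; rewrite in_itv/= andbT lee_fin => xt.
    have t0 : 0 < t by exact: lt_trans xt.
    rewrite -mulrA ler_pdivlMl//.
    apply: le_trans (euler_primitive_le x0 (ltW t0)).
    rewrite /euler_primitive -(mulr_powRB1 (ltW t0) x0) -mulrA.
    by apply: ler_wpM2r; [exact: euler_integrand_ge0|exact: ltW].
have dE t : is_derive t 1 (fun s => - (2 * C) * expR (- (s / 2)))
    (C * expR (- (t / 2))).
  by apply: is_derive_eq; rewrite /GRing.scale/=; field.
suff -> : (\int[mu]_(t in `[x, +oo[) (C * expR (- (t / 2)))%:E =
    0%:E - (- (2 * C) * expR (- (x / 2)))%:E)%E by rewrite -EFinB ltry.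
apply: (@ge0_continuous_FTC2y _ _ (fun s => - (2 * C) * expR (- (s / 2)))).
- by move=> t _; rewrite mulr_ge0// expR_ge0.
- exact: continuous_subspaceT.
- rewrite -(mulr0 (- (2 * C))); apply: cvgMr.
  apply: (@cvg_comp _ _ _ (fun t => t / 2) (fun t => expR (- t)) _ +oo).
    exact: gt0_cvgMly.
  exact: cvgr_expR.
- by move=> t _; have [] := dE t.
- have cx : {for x, continuous (fun s : R => - (2 * C) * expR (- (s / 2)))}.
    apply/differentiable_continuous/derivable1_diffP.
    by have [] := dE x.
  exact/cvg_at_right_filter/cx.
- by move=> t _; rewrite derive1E; have [_ ->] := dE t.
Qed.

Let GammaE x : 0 < x -> (Gamma x)%:E = Eint x `]0%R, +oo[.
Proof.
move=> x0; rewrite /Gamma x0 big_ord0 invr1 mulr1 addr0.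
rewrite /euler_integral /Rintegral fineK// ge0_fin_numE.
  exact: integral_euler_lt_pinfty.
by apply: integral_ge0 => t _; rewrite lee_fin euler_integrand_ge0.
Qed.

Lemma Gamma_recurrence x : 0 < x -> Gamma (x + 1) = x * Gamma x.
Proof.
move=> x0; apply: EFin_inj; rewrite GammaE ?addr_gt0// EFinM GammaE//.
by have [] := integral_euler_recurrence x0.
Qed.

Lemma Gamma_gt0 x : 0 < x -> 0 < Gamma x.
Proof.
move=> x0; have [_] := integral_euler_recurrence x0.
rewrite -GammaE// -EFinM lee_fin => /(lt_le_trans _) H.
by rewrite -(pmulr_rgt0 _ x0) H// mulr_gt0 ?powR_gt0 ?expR_gt0.
Qed.

Lemma Gamma_opp_neq0 x : 0 < x < 1 -> Gamma (- x) != 0.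
Proof.
move=> /andP[x0 x1]; rewrite /Gamma oppr_gt0 ltNge ltW//= opprK.
(* Here the continuation reads Gamma (- x) = Gamma (1 - x) / (- x). *)
have -> : Num.truncn x = 0%N by apply/truncn0Pn; rewrite -ltNge.
have : 0 < Gamma (1 - x) by rewrite Gamma_gt0// subr_gt0.
rewrite /Gamma subr_gt0 x1 big_ord0 invr1 mulr1 addr0 => G0.
rewrite big_ord_recr big_ord0/= mul1r addr0 addrC.
by rewrite mulf_neq0 ?invr_eq0 ?oppr_eq0 ?gt_eqF.
Qed.

End euler_integral_theory.

(** * Sums over the integers *)

Section sums_over_int.
Context {R : realType}.
Implicit Types (f : int -> R) (M : R).

Lemma esum_int_halves f : (forall j, 0 <= f j) ->
  (\esum_(j in [set: int]) (f j)%:E =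
   \sum_(n <oo) (f (Posz n))%:E + \sum_(n <oo) (f (Negz n))%:E)%E.
Proof.
move=> f0; have F0 j : (0 <= (f j)%:E)%E by rewrite lee_fin.
rewrite (esumID (range Posz))// !setTI.
have -> : ~` range Posz = range Negz.
  apply/seteqP; split=> [[n|n]|_ [n _ <-] [m _ //]].
    by move=> H; exfalso; apply: H; exists n.
  by move=> _; exists n.
have [pinj ninj] : set_inj setT Posz /\ set_inj setT Negz.
  by split=> m n _ _ [].
rewrite !esum_set_image//.
by congr (_ + _)%E; apply: eq_eseriesl => n; rewrite in_setT.
Qed.

Lemma nneseries_le (a : nat -> R) M : (forall n, 0 <= a n) ->
  (forall N, \sum_(0 <= n < N) a n <= M) ->
  (\sum_(n <oo) (a n)%:E <= M%:E)%E.
Proof.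
move=> a0 aM; apply: lime_le.
  by apply: is_cvg_nneseries => n _ _; rewrite lee_fin.
by apply: nearW => N; rewrite sumEFin lee_fin.
Qed.

Lemma esum_int_lt_pinfty f M : (forall j, 0 <= f j) ->
  (forall N, \sum_(0 <= n < N) f (Posz n) <= M) ->
  (forall N, \sum_(0 <= n < N) f (Negz n) <= M) ->
  (\esum_(j in [set: int]) (f j)%:E < +oo)%E.
Proof.
move=> f0 fp fn; rewrite esum_int_halves//.
by apply: lte_add_pinfty; apply: le_lt_trans (nneseries_le _ _) (ltry M).
Qed.

Lemma esum_int_pinfty f (c : R) : (forall j, 0 <= f j) -> 0 < c ->
  (forall n, c * harmonic n <= f (Negz n)) ->
  (\esum_(j in [set: int]) (f j)%:E = +oo)%E.
Proof.
move=> f0 c0 cf; apply: contrapT => /eqP; rewrite -ltey => foo.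
have fin : \esum_(j in [set: int]) (f j)%:E \is a fin_num.
  by rewrite ge0_fin_numE// esum_ge0// => j _; rewrite lee_fin.
set s := esum _ _ in fin.
apply: (@dvg_harmonic R); apply: nondecreasing_is_cvgn.
  by apply: nondecreasing_series => n _ _; exact: harmonic_ge0.
exists (fine s / c) => _ [N _ <-].
rewrite ler_pdivlMr// mulrC mulr_sumr -lee_fin fineK//.
rewrite /s esum_int_halves//.
apply: (@le_trans _ _ (\sum_(n <oo) (f (Negz n))%:E)%E).
  apply: (@le_trans _ _ (\sum_(0 <= n < N) (f (Negz n))%:E)%E).
    by rewrite sumEFin lee_fin; apply: ler_sum => n _; exact: cf.
  by apply: nneseries_lim_ge => n _ _; rewrite lee_fin.
by rewrite leeDr// nneseries_ge0// => n _ _; rewrite lee_fin.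
Qed.

End sums_over_int.

(** * Summability and second moment of the fractional kernel *)

Section gamma_quotient_sequence.
Context {R : realType} (h : R) (a : nat -> R).
Hypotheses (h_gt0 : 0 < h) (h_lt1 : h < 1) (a_gt0 : forall n, 0 < a n).
Hypothesis a_rec : forall n,
  (n%:R + 2 + h) * a n.+1 = (n%:R + 1 - h) * a n.

(** Here a_n stands for k(n+1) and h for beta / 2. The recurrence makes
    2 h a_(n+1) the decrement of the nonnegative sequence (n + 1 - h) a_n. *)
Lemma gamma_quotient_sum_le N :
  \sum_(0 <= n < N) a n <= a 0%N + (1 - h) * a 0%N / (2 * h).
Proof.
have h2 : 0 < 2 * h by rewrite mulr_gt0.
have T0 n : 0 <= (n%:R + 1 - h) * a n.
  apply: mulr_ge0; last exact: ltW.
  by have := ler0n R n; move: h_lt1; lra.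
case: N => [|N].
  by rewrite big_geq// addr_ge0 ?divr_ge0 ?mulr_ge0 ?subr_ge0 ?ltW.
suff -> : \sum_(0 <= n < N.+1) a n =
    a 0%N + ((1 - h) * a 0%N - (N%:R + 1 - h) * a N) / (2 * h).
  by rewrite lerD2l ler_pM2r ?invr_gt0// gerBl.
elim: N => [|N IH]; first by rewrite big_nat1 add0r subrr mul0r addr0.
have E : a N.+1 * (2 * h) = (N%:R + 1 - h) * a N - (N.+1%:R + 1 - h) * a N.+1.
  by rewrite -a_rec -[N.+1%:R]natr1; ring.
rewrite big_nat_recr//= IH -addrA -[X in _ + (_ + X)](mulfK (lt0r_neq0 h2)).
by rewrite E -mulrDl; congr (_ + _ / _); ring.
Qed.

(** Since h < 1, the recurrence makes n (n + 1) (n + 2) a_n nondecreasing: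
    a_n decays at most like n^(-3), the borderline case h = 1. *)
Lemma gamma_quotient_ge :
  exists2 c, 0 < c & forall n, c * harmonic n <= a n * n.+1%:R ^+ 2.
Proof.
have b1 n : 6 * a 1%N <= n.+1%:R * n.+2%:R * n.+3%:R * a n.+1.
  elim: n => [|n IH]; first by rewrite mul1r -natrM.
  apply: le_trans IH _.
  rewrite [leLHS](_ : _ = n.+2%:R * n.+3%:R * (n.+1%:R * a n.+1)); last by ring.
  rewrite [leRHS](_ : _ = n.+2%:R * n.+3%:R * (n.+4%:R * a n.+2)); last by ring.
  apply: ler_wpM2l; first by rewrite mulr_ge0.
  apply: (@le_trans _ _ ((n.+1%:R + 1 - h) * a n.+1)).
    by apply: ler_wpM2r; [exact: ltW|move: h_lt1; lra].
  rewrite -a_rec; apply: ler_wpM2r; first exact: ltW.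
  by rewrite -[n.+4%:R]natr1 -[n.+3%:R]natr1 -[n.+2%:R]natr1; move: h_lt1; lra.
(* The monotone sequence vanishes at n = 0, whence the separate term a 0. *)
exists (Num.min (a 0%N) (6 * a 1%N)).
  by rewrite lt_min a_gt0 mulr_gt0.
move=> n; rewrite /harmonic/= ler_pdivrMr// -mulrA -exprSr.
case: n => [|n]; first by rewrite expr1n mulr1 ge_min lexx.
apply: le_trans (_ : 6 * a 1%N <= _); first by rewrite ge_min lexx orbT.
apply: le_trans (b1 n) _; rewrite mulrC; apply: ler_wpM2l; first exact: ltW.
rewrite -[n.+3%:R]natr1 -[n.+2%:R]natr1 -[n.+1%:R]natr1.
have : 0 <= n%:R :> R by [].
nra.
Qed.

End gamma_quotient_sequence.

Section fractional_kernel.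
Context {R : realType} (beta : R).
Hypotheses (beta_gt0 : 0 < beta) (beta_lt2 : beta < 2).
Let h := beta / 2.

Let h_gt0 : 0 < h. Proof. by rewrite divr_gt0. Qed.
Let h_lt1 : h < 1. Proof. by rewrite ltr_pdivrMr// mul1r. Qed.

Lemma frac_kernel0 : frac_kernel beta 0 = 0.
Proof. by rewrite /frac_kernel eqxx. Qed.

Lemma frac_kernel_Negz n : frac_kernel beta (Negz n) = frac_kernel beta n.+1.
Proof. by []. Qed.

Let C := 4 `^ h * Gamma ((1 + beta) / 2) / (Num.sqrt pi * `|Gamma (- h)|).

Let C_gt0 : 0 < C.
Proof.
rewrite divr_gt0// mulr_gt0 ?powR_gt0 ?Gamma_gt0 ?divr_gt0 ?addr_gt0//.
  by rewrite sqrtr_gt0 pi_gt0.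
by rewrite normr_gt0 Gamma_opp_neq0// h_gt0.
Qed.

Let frac_kernelE n : frac_kernel beta n.+1 =
  C * (Gamma (n%:R + 1 - h) / Gamma (n%:R + 2 + h)).
Proof.
rewrite /frac_kernel/= -/h /C -[n.+1%:R]natr1 -(addrA n%:R 1 1).
by rewrite invfM mulrACA [RHS]mulrCA; ring.
Qed.

Lemma frac_kernelS_gt0 (n : nat) : 0 < frac_kernel beta n.+1.
Proof.
rewrite frac_kernelE mulr_gt0// divr_gt0// Gamma_gt0//.
  by have := ler0n R n; move: h_lt1; lra.
by have := ler0n R n; move: h_gt0; lra.
Qed.

Lemma frac_kernel_ge0 j : 0 <= frac_kernel beta j.
Proof.
case: j => [[|n]|n]; first by rewrite frac_kernel0.
  exact/ltW/frac_kernelS_gt0.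
by rewrite frac_kernel_Negz; exact/ltW/frac_kernelS_gt0.
Qed.

Lemma frac_kernel_recurrence n :
  (n%:R + 2 + h) * frac_kernel beta n.+2 =
  (n%:R + 1 - h) * frac_kernel beta n.+1.
Proof.
have n0 := ler0n R n.
have p1 : 0 < n%:R + 1 - h by move: h_lt1; lra.
have p2 : 0 < n%:R + 2 + h by move: h_gt0; lra.
rewrite !frac_kernelE -[n.+1%:R]natr1.
rewrite (_ : n%:R + 1 + 1 - h = (n%:R + 1 - h) + 1); last by ring.
rewrite (_ : n%:R + 1 + 2 + h = (n%:R + 2 + h) + 1); last by ring.
rewrite !Gamma_recurrence//; field.
by rewrite !gt_eqF ?Gamma_gt0.
Qed.

Lemma frac_kernel_summable :
  (\esum_(j in [set: int]) (frac_kernel beta j)%:E < +oo)%E.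
Proof.
have aS := gamma_quotient_sum_le h_gt0 h_lt1 frac_kernelS_gt0
  frac_kernel_recurrence.
apply: (@esum_int_lt_pinfty _ _ _ frac_kernel_ge0 _ aS).
case=> [|N]; first by have := aS 0%N; rewrite !big_geq.
by rewrite big_nat_recl// frac_kernel0 add0r; exact: aS.
Qed.

Lemma frac_kernel_second_moment :
  (\esum_(j in [set: int]) (frac_kernel beta j * j%:~R ^+ 2)%:E = +oo)%E.
Proof.
have [c c0 ac] := gamma_quotient_ge h_lt1 frac_kernelS_gt0
  frac_kernel_recurrence.
apply: (esum_int_pinfty _ c0) => [j|n].
  by rewrite mulr_ge0 ?frac_kernel_ge0 ?sqr_ge0.
by rewrite NegzE rmorphN sqrrN; exact: ac.
Qed.

End fractional_kernel.

Theorem corollary3p1 (R : realType) (beta : R)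
    (beta_gt0 : 0 < beta) (beta_lt2 : beta < 2)
    (d : R) (d_gt0 : 0 < d) :
  ~ CD0 (frac_kernel beta) d.
Proof.
apply: CD0_fails_of_infinite_second_moment d_gt0.
- exact: frac_kernel_ge0.
- exact: frac_kernel_summable.
- exact: frac_kernel_second_moment.
Qed.
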